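(* Let $\gamma\in\Theta(1)$. Then there exists $\varepsilon=\varepsilon_\gamma\in(0,1)$ such that any compact set $E\subset[0,1]$ with $\dim_H(E)>1-\varepsilon$ contains a nontrivial configuration of the form $$\{x,\ x-t,\ x-\gamma_\lambda(t)\}$$ for some $x\in\mathbb{R}$ and $\lambda,t>0$ (with $\lambda t\in[0,1]$, so that $\gamma_\lambda(t)$ is defined).
   Context: $\dim_H$ is the usual Hausdorff dimension. For a function $\gamma$ and $\lambda>0$, $\gamma_\lambda(t):=\lambda^{-1}\gamma(\lambda t)$. ''Nontrivial'' means that $t\neq 0$ (here $t>0$). $\Theta$ is the family of real-analytic curves $\gamma:[0,1]\to\mathbb{R}$ that are not affine maps, satisfy $\gamma(0)=0$, and are such that: (1) there do not exist $a,b_1,b_2\in\mathbb{C}$ with $a,b_1\neq 0$ such that $\gamma$ is of the form $\gamma(t)=\frac1a\log(b_1e^{at}+b_2)$; (2) for all $t\in(0,1)$, $\gamma'(t)\neq 0$ and $|1-\gamma'(t)|+|\gamma''(t)|\neq 0$; (3) $|\gamma(t)|\lesssim|t|$ for all sufficiently small $t$. For an integer $M\ge 1$, $\Theta(M)$ is the family of curves $\gamma\in\Theta$ such that $|\gamma(t)|\le M|t|$ for all sufficiently small $t$; in particular $\Theta(1)$ requires $|\gamma(t)|\le |t|$ for all sufficiently small $t$. *)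

(* Defs.v *)
From mathcomp Require Import all_boot all_order all_algebra.
From mathcomp Require Import all_classical all_reals all_analysis.
From mathcomp Require Import complex.

Set Implicit Arguments.
Unset Strict Implicit.
Unset Printing Implicit Defensive.

Import Order.TTheory GRing.Theory Num.Theory.
Import numFieldNormedType.Exports.

Local Open Scope classical_set_scope.
Local Open Scope ring_scope.
Local Open Scope complex_scope.

Section Hausdorff.
Context {R : realType}.
Implicit Types (s d : R) (A : set R).
Local Open Scope ereal_scope.

(* [diam set0] is -oo, the supremum of the empty set in \bar R. *)
Definition diam A : \bar R :=
  ereal_sup [set `|p.1 - p.2|%:E | p in A `*` A].

(* The empty set has weight 0 for every s, while a singleton has weight
   [0 `^ 0 = 1] for s = 0. *)
Definition hausdorff_weight s A : \bar R :=
  if A == set0 then 0 else diam A `^ s.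

Definition hausdorff_premeasure s d A : \bar R :=
  ereal_inf [set \sum_(0 <= i <oo) hausdorff_weight s (U i) |
    U in [set U : (set R)^nat |
      A `<=` \bigcup_i U i /\ forall i, diam (U i) <= d%:E]].

(* The premeasure is nonincreasing in d, so this supremum is its limit as
   d tends to 0. *)
Definition hausdorff_measure s A : \bar R :=
  ereal_sup [set hausdorff_premeasure s d A | d in [set d : R | (0 < d)%R]].

Definition hausdorff_dim A : \bar R :=
  ereal_inf [set s%:E | s in
    [set s : R | (0 <= s)%R /\ hausdorff_measure s A = 0]].

End Hausdorff.

Definition cexp {R : realType} (z : R[i]) : R[i] :=
  (expR (complex.Re z) * cos (complex.Im z)) +i*
  (expR (complex.Re z) * sin (complex.Im z)).

(* Curves on [0, 1] are represented by functions R -> R of which only the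
   values on [0, 1] are used; first and second derivatives are only taken in
   the open interval. *)
Section Curves.
Context {R : realType}.
Implicit Types g : R -> R.

(* Local power series expansions relative to the closed interval: at 0 and 1
   they only have to represent g on the side lying in [0, 1].  This amounts to
   g having an analytic extension to a neighbourhood of [0, 1]. *)
Definition analytic01 g :=
  forall t0 : R, t0 \in `[0, 1] -> exists (c : R^nat) (r : R), 0 < r /\
    forall t : R, t \in `[0, 1] -> `|t - t0| < r ->
      pseries c (t - t0) @ \oo --> g t.

Definition affine01 g :=
  exists u v : R, forall t : R, t \in `[0, 1] -> g t = u * t + v.

(* [w] ranges over the complex logarithms of b1 e^(at) + b2, so no particular
   branch of the logarithm is singled out. *)
Definition log_form g :=
  exists a b1 b2 : R[i], [/\ a != 0, b1 != 0 &
    forall t : R, t \in `[0, 1] -> exists w : R[i],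
      cexp w = b1 * cexp (a * t%:C) + b2 /\ (g t)%:C = a^-1 * w].

(* |g t| <= M |t| for all sufficiently small t in [0, 1] *)
Definition small_bound (M : R) g :=
  \forall t \near (0 : R), t \in `[0, 1] -> `|g t| <= M * `|t|.

Record Theta g : Prop := {
  Theta_analytic : analytic01 g ;
  Theta_not_affine : ~ affine01 g ;
  Theta_at0 : g 0 = 0 ;
  Theta_not_log : ~ log_form g ;
  Theta_deriv : forall t : R, t \in `]0, 1[ ->
    derive1 g t != 0 /\ `|1 - derive1 g t| + `|derive1n 2 g t| != 0 ;
  Theta_small : exists C : R, small_bound C g }.

Definition Theta_bounded (M : nat) g := Theta g /\ small_bound M%:R g.

Definition rescale (l : R) g (t : R) : R := l^-1 * g (l * t).

End Curves.

(* Main.v *)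
Require Import Defs.
From mathcomp Require Import all_boot all_order all_algebra.
From mathcomp Require Import all_classical all_reals all_analysis.
From mathcomp Require Import ring lra.

(** The statement does not see the curve itself, only its slopes
    [r = g s / s]: with [s = l * t] the configuration is
    [{x, x - t, x - r * t}], and since [l] is free, [t > 0] and [s] in ]0, 1]
    can be chosen independently.  As [g] is continuous on [0, 1], vanishes at
    0 and is not affine, its slopes are not all equal, so by the intermediate
    value theorem they fill a nondegenerate interval
    ([slopes_fill_interval]).

    Up to order, [x], [x - t], [x - r * t] are two extreme points [Y < X] and
    a middle point [X - u * (X - Y)], where the position [u] is a monotone
    function of [r] on each of the ranges [r < 0], [0 < r < 1] and [r > 1].
    Hence an interval of slopes contains all the slopes that realize the
    positions of some interval ]p, q[ ([position_of_ratio]).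

    A compact set [E] without configuration thus never contains a point at a
    position in ]p, q[ between two of its points.  Applied to the extreme
    points of [E] in an interval of length [L], this leaves a gap of
    proportion [q - p]: that part of [E] lies in two intervals of lengths at
    most [(1 - q) * L] and [p * L] ([avoids_positions_split]).  Iterating as
    for a Cantor set ([avoids_positions_cover]), the sums of the [s]-th powers
    of the lengths shrink at each step by the factor [(1 - q)^s + p^s].  This is
    [1 - (q - p) < 1] for [s = 1], hence still less than 1 for some [s < 1],
    and for this [s], which depends on [p] and [q] only, [E] has dimension at
    most [s] ([avoids_positions_dim]).  So [eps = 1 - s] works. *)

Set Implicit Arguments.
Unset Strict Implicit.
Unset Printing Implicit Defensive.

Import Order.TTheory GRing.Theory Num.Theory.
Import numFieldNormedType.Exports.

Local Open Scope classical_set_scope.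
Local Open Scope ring_scope.

(** * Continuity of real-analytic curves *)

(** Convergence at [k0] makes the series converge absolutely at [|k0| / 2],
    and one factor [x] can be taken out of all the terms after the constant
    one.  The bound concerns any sum [l] of the series at [x], and for [x = 0]
    it says that the sum is the constant term. *)
Lemma pseries_lipschitz_center (R : realType) (c : R^nat) (k0 : R) :
  k0 != 0 -> cvgn (exp.pseries c k0) ->
  exists M : R, forall x l : R, `|x| < `|k0| / 2 ->
    exp.pseries c x @ \oo --> l -> `|l - c 0%N| <= M * `|x|.
Proof.
move=> k0_neq0 cvg_k0; set k := `|k0| / 2.
have k_gt0 : 0 < k by rewrite divr_gt0// normr_gt0.
have cvg_abs : cvgn (exp.pseries (fun i => `|c i|) k).
  apply: is_cvg_pseries_inside_norm cvg_k0 _.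
  by rewrite gtr0_norm// /k gtr_pMr ?normr_gt0//; lra.
exists (limn (exp.pseries (fun i => `|c i|) k) / k) => x l xk cvg_l.
have cvg_dist : `|exp.pseries c x n - c 0%N| @[n --> \oo] --> `|l - c 0%N|.
  by apply: cvg_norm; apply: cvgB => //; exact: cvg_cst.
rewrite -(cvg_lim _ cvg_dist)//; apply: limr_le; first exact: cvgP cvg_dist.
near=> n.
have n_gt0 : (0 < n)%N by near: n; exact: nbhs_infty_gt.
rewrite -(prednK n_gt0) /exp.pseries /series/= big_nat_recl// expr0 mulr1 addrC addKr.
have nondec : nondecreasing_seq (exp.pseries (fun i => `|c i|) k).
  by apply: nondecreasing_series => i _ _; rewrite mulr_ge0// exprn_ge0// ltW.
have := nondecreasing_cvgn_le nondec cvg_abs n.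
rewrite {1}/exp.pseries /series/= -{1}(prednK n_gt0) big_nat_recl// => partial_le.
apply: le_trans (ler_norm_sum _ _ _) _.
rewrite mulrAC ler_pdivlMr// mulrC.
apply: (@le_trans _ _ (`|x| * \sum_(0 <= i < n.-1) `|c i.+1| * k ^+ i.+1)).
  rewrite !mulr_sumr; apply: ler_sum => i _.
  rewrite normrM normrX !exprS.
  have : `|x| ^+ i <= k ^+ i by rewrite lerXn2r ?nnegrE// ltW.
  have := normr_ge0 (c i.+1); have := normr_ge0 x => x0 c0 le_pow.
  rewrite [leLHS](_ : _ = (k * `|x| * `|c i.+1|) * `|x| ^+ i); last ring.
  rewrite [leRHS](_ : _ = (k * `|x| * `|c i.+1|) * k ^+ i); last ring.
  by apply: ler_wpM2l => //; rewrite !mulr_ge0// ltW.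
rewrite mulrC ler_wpM2r//; apply: le_trans partial_le.
by rewrite lerDr mulr_ge0// exprn_ge0// ltW.
Unshelve. all: by end_near. Qed.

(** Continuity at [t0] only requires the expansion centred at [t0] itself, and
    a convergence point on one side of [t0] controls the series on both: this
    is why the end points of [0, 1] need no separate treatment. *)
Lemma analytic01_continuous (R : realType) (g : R -> R) :
  analytic01 g -> {within `[0, 1], continuous g}.
Proof.
move=> g_an; apply/subspace_continuousP => t0 t0_in.
have t0_itv : t0 \in `[0, 1] by [].
have [c [r [r_gt0 g_eq]]] := g_an t0 t0_itv.
(* A point of [0, 1] other than [t0] where the expansion converges; the step
   is taken towards the far end point, which is at distance at least 1/2. *)
have [t1 t1_itv t1_near] : exists2 t1, t1 \in `[0, 1] & 0 < `|t1 - t0| < r.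
  move: t0_itv; rewrite in_itv/= => /andP[t0_ge0 t0_le1].
  pose e := Num.min (r / 2) (1 / 2).
  have [e_gt0 e_r e_half] : [/\ 0 < e, e <= r / 2 & e <= 1 / 2].
    split; [|by rewrite ge_min lexx | by rewrite ge_min lexx orbT].
    by rewrite lt_min; apply/andP; split; lra.
  have [t0_small|t0_large] := leP t0 (1 / 2).
    exists (t0 + e); first by rewrite in_itv/=; apply/andP; split; lra.
    by rewrite addrC addKr gtr0_norm//; apply/andP; split; lra.
  exists (t0 - e); first by rewrite in_itv/=; apply/andP; split; lra.
  by rewrite addrC addKr normrN gtr0_norm//; apply/andP; split; lra.
have /andP[t1_gt0 t1_r] := t1_near.
have [M M_lip] : exists M : R, forall x l : R, `|x| < `|t1 - t0| / 2 ->
    exp.pseries c x @ \oo --> l -> `|l - c 0%N| <= M * `|x|.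
  apply: pseries_lipschitz_center; first by rewrite -normr_gt0.
  by apply: cvgP; exact: g_eq.
have g_t0 : g t0 = c 0%N.
  apply/eqP; rewrite -subr_eq0 -normr_le0.
  have := M_lip 0 (g t0); rewrite normr0 mulr0; apply; first lra.
  by rewrite -(subrr t0); apply: g_eq => //; rewrite subrr normr0.
rewrite /from_subspace g_t0.
have lip_cvg : (c 0%N - M * `|t - t0|) @[t --> within `[0, 1] (nbhs t0)] --> c 0%N
            /\ (c 0%N + M * `|t - t0|) @[t --> within `[0, 1] (nbhs t0)] --> c 0%N.
  have dist_cvg0 (u : R) : M * `|t - u| @[t --> u] --> (0 : R).
    rewrite -[X in _ --> X](mulr0 M) -[X in M * X](normr0 R) -[X in `|X|](subrr u).
    by apply: cvgMr; apply: cvg_norm; apply: cvgB; [exact: cvg_id|exact: cvg_cst].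
  have dist_cvg : M * `|t - t0| @[t --> within `[0, 1] (nbhs t0)] --> (0 : R).
    exact: cvg_within_filter (dist_cvg0 t0).
  split; first by rewrite -[X in _ --> X]subr0; apply: cvgB => //; exact: cvg_cst.
  by rewrite -[X in _ --> X]addr0; apply: cvgD => //; exact: cvg_cst.
apply: (squeeze_cvgr _ lip_cvg.1 lip_cvg.2).
rewrite near_withinE; near=> t => t_in.
rewrite -ler_distl.
have t_close : `|t - t0| < `|t1 - t0| / 2.
  rewrite distrC; near: t.
  have half_gt0 : 0 < `|t1 - t0| / 2 by lra.
  exact: (nbhsx_ballx _ _ half_gt0).
by apply: M_lip => //; apply: g_eq => //; apply: lt_trans t_close _; lra.
Unshelve. all: by end_near. Qed.

(** * Slopes and positions *)

(** If all the slopes [g s / s] with [0 < s <= 1] were equal to [g 1], then [g]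
    would be linear; between two different slopes the intermediate value
    theorem gives all the others. *)
Lemma slopes_fill_interval (R : realType) (g : R -> R) :
  {within `[0, 1], continuous g} -> ~ affine01 g -> g 0 = 0 ->
  exists2 ab : R * R, ab.1 < ab.2 &
    forall r : R, ab.1 < r < ab.2 -> exists2 s : R, 0 < s <= 1 & g s = r * s.
Proof.
move=> g_cont g_naff g0.
have slope_between (s1 s2 r : R) : 0 < s1 <= 1 -> 0 < s2 <= 1 ->
    g s1 < r * s1 -> r * s2 < g s2 -> exists2 s : R, 0 < s <= 1 & g s = r * s.
  move=> /andP[s1_gt0 s1_le1] /andP[s2_gt0 s2_le1] below above.
  (* Unlike the slope, this difference is continuous at 0 too. *)
  pose f t := g t - r * t.
  have f_cont : {within `[0, 1], continuous f}.
    apply/subspace_continuousP => x x_in; rewrite /from_subspace; apply: cvgB.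
      by move/subspace_continuousP: g_cont; exact.
    by apply: cvg_within_filter; apply: cvgMr; exact: cvg_id.
  have f_s1 : f s1 <= 0 by rewrite /f; lra.
  have f_s2 : 0 <= f s2 by rewrite /f; lra.
  have [le12|/ltW le21] := leP s1 s2.
    have [||s] := @IVT R f s1 s2 0 le12.
    - apply: continuous_subspaceW f_cont => x /=; rewrite !in_itv/= => /andP[? ?].
      by apply/andP; split; lra.
    - by rewrite ge_min f_s1 le_max f_s2 orbT.
    - rewrite in_itv/= => /andP[? ?] /eqP; rewrite subr_eq0 => /eqP gs.
      by exists s => //; apply/andP; split; lra.
  have [||s] := @IVT R f s2 s1 0 le21.
  - apply: continuous_subspaceW f_cont => x /=; rewrite !in_itv/= => /andP[? ?].
    by apply/andP; split; lra.
  - by rewrite ge_min f_s1 le_max f_s2 orbT.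
  - rewrite in_itv/= => /andP[? ?] /eqP; rewrite subr_eq0 => /eqP gs.
    by exists s => //; apply/andP; split; lra.
have slopes_to (s1 s2 : R) : 0 < s1 <= 1 -> 0 < s2 <= 1 -> g s1 / s1 < g s2 / s2 ->
    exists2 ab : R * R, ab.1 < ab.2 &
    forall r : R, ab.1 < r < ab.2 -> exists2 s : R, 0 < s <= 1 & g s = r * s.
  move=> s1_in s2_in lt12; exists (g s1 / s1, g s2 / s2) => //= r /andP[lt1 lt2].
  by apply: (slope_between s1 s2) => //;
    [rewrite -ltr_pdivrMr//; case/andP: s1_in | rewrite -ltr_pdivlMr//; case/andP: s2_in].
apply: contrapT => no_interval; apply: g_naff; exists (g 1), 0 => t.
rewrite in_itv/= => /andP[t_ge0 t_le1]; rewrite addr0.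
have [->|t_neq0] := eqVneq t 0; first by rewrite g0 mulr0.
have t_in : 0 < t <= 1 by rewrite lt_neqAle eq_sym t_neq0 t_ge0.
have one_in : (0 : R) < (1 : R) <= 1 by apply/andP; split; lra.
have [lt|lt|eq] := ltgtP (g t / t) (g 1 / 1).
- by case: no_interval; exact: slopes_to t_in one_in lt.
- by case: no_interval; exact: slopes_to one_in t_in lt.
- by rewrite -[g 1]divr1 -eq mulfVK.
Qed.

Definition avoids_positions {R : realType} (p q : R) (E : set R) :=
  forall X Y u : R, E X -> E Y -> Y < X -> p < u < q -> ~ E (X - u * (X - Y)).

(** The three cases give [x - r * t], [x] or [x - t] as the middle point:
    - for [0 < r < 1], [u = r];
    - for [r < 0], [x - r * t] is the largest point and [u = - r / (1 - r)];
    - for [r > 1], [x - r * t] is the smallest point and [u = r^-1].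
    A nonempty interval ]al, be[ always meets one of these ranges in a
    nondegenerate interval, whose image is the interval of positions. *)
Lemma position_of_ratio (R : realType) (al be : R) : al < be ->
  exists p q : R, [/\ 0 <= p, p < q, q <= 1 & forall u : R, p < u < q ->
    exists2 r : R, al < r < be & forall (E : set R) (X Y : R), Y < X ->
      E X -> E Y -> E (X - u * (X - Y)) ->
      exists2 xt : R * R, 0 < xt.2 &
        [/\ E xt.1, E (xt.1 - xt.2) & E (xt.1 - r * xt.2)]].
Proof.
move=> lt_ab.
have [be_le0|be_gt0] := leP be 0.
  exists (- be / (1 - be)), (- al / (1 - al)); split.
  - by rewrite divr_ge0; lra.
  - by rewrite ltr_pdivrMr; [rewrite mulrAC ltr_pdivlMr; [nra|lra]|lra].
  - by rewrite ler_pdivrMr; lra.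
  move=> u /andP[]; rewrite ltr_pdivrMr; last lra.
  rewrite ltr_pdivlMr; last lra; move=> lt_bu lt_ua.
  have u_lt1 : 0 < 1 - u by nra.
  exists (- u / (1 - u)).
    by rewrite ltr_pdivlMr// ltr_pdivrMr//; apply/andP; split; lra.
  move=> E X Y ltYX EX EY EU; exists (X - u * (X - Y), (1 - u) * (X - Y)) => /=.
    by rewrite mulr_gt0// subr_gt0.
  split=> //; first by move: EY; congr E; ring.
  by move: EX; congr E; field; rewrite gt_eqF.
have [al_ge1|al_lt1] := leP 1 al.
  exists (be^-1), (al^-1); split.
  - by rewrite invr_ge0 ltW.
  - by rewrite ltf_pV2// posrE; lra.
  - by rewrite invf_le1//; lra.
  have al_gt0 : 0 < al by lra.
  have be_gt1 : 1 < be by lra.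
  move=> u /andP[]; rewrite -[be^-1]mul1r -[al^-1]mul1r ltr_pdivrMr// ltr_pdivlMr//.
  move=> lt_1ub lt_ua1.
  have u_gt0 : 0 < u by nra.
  exists (u^-1).
    by rewrite -[u^-1]mul1r ltr_pdivlMr// ltr_pdivrMr//; apply/andP; split; lra.
  move=> E X Y ltYX EX EY EU; exists (X, u * (X - Y)) => /=.
    by rewrite mulr_gt0// subr_gt0.
  split=> //; move: EY; congr E; field; by rewrite gt_eqF.
exists (Num.max al 0), (Num.min be 1); split.
- by rewrite le_max lexx orbT.
- by rewrite gt_max !lt_min lt_ab al_lt1 be_gt0 ltr01.
- by rewrite ge_min lexx orbT.
move=> u; rewrite gt_max lt_min => /andP[/andP[lt_au u_gt0] /andP[lt_ub u_lt1]].
exists u; first by rewrite lt_au.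
move=> E X Y ltYX EX EY EU; exists (X, X - Y); rewrite /= ?subr_gt0//.
by split=> //; rewrite subKr.
Qed.

(** * Dimension of sets avoiding an interval of positions *)

(** [Y] and [X] are the extreme points of [E] in [a, b]; no point of [E]
    between them lies at a position in ]p, q[. *)
Lemma avoids_positions_split (R : realType) (p q : R) (E : set R) (a b : R) :
  compact E -> avoids_positions p q E -> a <= b ->
  exists2 yx : R * R, 0 <= yx.2 - yx.1 <= b - a &
    E `&` `[a, b] `<=` `[yx.1, yx.1 + (1 - q) * (yx.2 - yx.1)] `|`
                       `[yx.2 - p * (yx.2 - yx.1), yx.2].
Proof.
move=> cE avoid le_ab.
have [[z0 Ez0]|/nonemptyPn emptyE] := pselect (E `&` `[a, b] !=set0); last first.
  by exists (a, a); rewrite /= ?subrr ?lexx ?subr_ge0// emptyE.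
have cEab : compact (E `&` `[a, b]).
  by apply: compact_closedI => //; exact: interval_closed.
have id_cont : {within E `&` `[a, b], continuous (@id R)}.
  by apply: continuous_subspaceT => x; exact: cvg_id.
have [X /set_mem[EX X_in] X_max] := compact_EVT_max (ex_intro _ z0 Ez0) cEab id_cont.
have [Y /set_mem[EY Y_in] Y_min] := compact_EVT_min (ex_intro _ z0 Ez0) cEab id_cont.
have leYX : Y <= X by apply: Y_min; apply/mem_set.
exists (Y, X) => /=.
  by move: X_in Y_in; rewrite /= !in_itv/= => /andP[? ?] /andP[? ?]; apply/andP; split; lra.
move=> z Ez; have leYz : Y <= z by apply: Y_min; apply/mem_set.
have lezX : z <= X by apply: X_max; apply/mem_set.
have {Ez} Ez := Ez.1.
move: leYX; rewrite le_eqVlt => /predU1P[eqYX|ltYX].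
  by left; rewrite /= in_itv/= leYz eqYX subrr mulr0 addr0.
have d_gt0 : 0 < X - Y by rewrite subr_gt0.
have [lt_zq|le_qz] := ltP (Y + (1 - q) * (X - Y)) z; last by left; rewrite /= in_itv/= leYz.
have [lt_zp|le_pz] := ltP z (X - p * (X - Y)); last by right; rewrite /= in_itv/= le_pz.
exfalso; apply: (avoid X Y ((X - z) / (X - Y))) => //.
  by rewrite ltr_pdivrMr// ltr_pdivlMr//; apply/andP; split; lra.
by move: Ez; congr E; field; rewrite gt_eqF.
Qed.

Definition covered_by {R : realType} (A : set R) (l : seq (R * R)) :=
  forall z : R, A z -> exists2 I, I \in l & I.1 <= z <= I.2.

Definition lengths_le {R : realType} (d : R) (l : seq (R * R)) :=
  forall I, I \in l -> 0 <= I.2 - I.1 <= d.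

(** The two intervals given by [avoids_positions_split] may be covered
    recursively because the hypothesis on [E] is invariant under scaling.  The
    factor for the lengths is [1 - (q - p) = (1 - q) + p], which bounds both
    [1 - q] and [p]. *)
Lemma avoids_positions_cover (R : realType) (p q s : R) (E : set R) :
  0 <= p -> p < q -> q <= 1 -> 0 < s -> compact E -> avoids_positions p q E ->
  forall (n : nat) (a b : R), a <= b -> exists l : seq (R * R),
    [/\ covered_by (E `&` `[a, b]) l, lengths_le ((1 - (q - p)) ^+ n * (b - a)) l &
      \sum_(I <- l) (I.2 - I.1) `^ s <= ((1 - q) `^ s + p `^ s) ^+ n * (b - a) `^ s].
Proof.
move=> p_ge0 lt_pq q_le1 s_gt0 cE avoid; elim=> [|n IHn] a b le_ab.
  exists [:: (a, b)]; split.
  - by move=> z [_ /=]; rewrite in_itv/= => z_in; exists (a, b); rewrite ?mem_head.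
  - by move=> I; rewrite inE => /eqP->; rewrite expr0 mul1r lexx subr_ge0 le_ab.
  - by rewrite big_seq1 expr0 mul1r.
have [[y x] /= /andP[d_ge0 d_le] E_sub] := avoids_positions_split cE avoid le_ab.
set d := x - y in d_ge0 d_le E_sub.
have q'_ge0 : 0 <= 1 - q by lra.
have c_ge0 : 0 <= 1 - (q - p) by lra.
have [|l1 [cov1 len1 sum1]] := IHn y (y + (1 - q) * d); first by rewrite lerDl mulr_ge0.
have [|l2 [cov2 len2 sum2]] := IHn (x - p * d) x; first by rewrite gerBl mulr_ge0.
rewrite [y + _]addrC addrK in len1 sum1; rewrite subKr in len2 sum2.
have step (k : R) : 0 <= k -> k <= 1 - (q - p) ->
    (1 - (q - p)) ^+ n * (k * d) <= (1 - (q - p)) ^+ n.+1 * (b - a).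
  move=> k_ge0 k_le; rewrite exprSr -mulrA ler_wpM2l ?exprn_ge0//.
  by rewrite ler_pM.
exists (l1 ++ l2); split.
- move=> z [Ez z_in]; have [z1|z2] := E_sub z (conj Ez z_in).
  + by have [I I1 zI] := cov1 z (conj Ez z1); exists I; rewrite // mem_cat I1.
  + by have [I I2 zI] := cov2 z (conj Ez z2); exists I; rewrite // mem_cat I2 orbT.
- move=> I; rewrite mem_cat => /orP[/len1|/len2] /andP[-> /= /le_trans]; apply; apply: step; lra.
- rewrite big_cat/=; apply: le_trans (lerD sum1 sum2) _.
  rewrite -mulrDr !powRM// -mulrDl exprSr -mulrA.
  rewrite ler_wpM2l ?exprn_ge0 ?addr_ge0 ?powR_ge0//.
  by rewrite ler_wpM2l ?addr_ge0 ?powR_ge0// ge0_ler_powR ?nnegrE//; [exact: ltW|lra].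
Qed.

Lemma diam_segment (R : realType) (a b : R) : (diam `[a, b] <= (b - a)%:E)%E.
Proof.
apply: ge_ereal_sup => _ [[u v] /= [u_in v_in] <-].
move: u_in v_in; rewrite !in_itv/= => /andP[? ?] /andP[? ?].
by rewrite lee_fin ler_norml; apply/andP; split; lra.
Qed.

Lemma diam_ge0 (R : realType) (A : set R) : A !=set0 -> (0 <= diam A)%E.
Proof.
move=> [a Aa]; apply: ereal_sup_ubound; exists (a, a) => //=.
by rewrite subrr normr0.
Qed.

Lemma hausdorff_weight_ge0 (R : realType) (s : R) (A : set R) :
  (0 <= hausdorff_weight s A)%E.
Proof. by rewrite /hausdorff_weight; case: ifP => // _; exact: poweR_ge0. Qed.

Lemma hausdorff_weight_segment (R : realType) (s a b : R) : 0 < s -> a <= b ->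
  (hausdorff_weight s `[a, b] <= ((b - a) `^ s)%:E)%E.
Proof.
move=> s_gt0 le_ab; rewrite /hausdorff_weight ifF; last first.
  by apply/eqP/eqP/set0P; exists a; rewrite /= in_itv/= lexx.
rewrite -poweR_EFin gt0_ler_poweR ?(ltW s_gt0) ?diam_segment//.
  rewrite in_itv/= leey andbT; apply: diam_ge0.
  by exists a; rewrite /= in_itv/= lexx.
by rewrite in_itv/= leey andbT lee_fin subr_ge0.
Qed.

(** A finite cover is completed to a sequence by empty sets, which weigh 0 and
    whose diameter is below any bound. *)
Lemma hausdorff_premeasure_le (R : realType) (s d : R) (A : set R) (l : seq (R * R)) :
  0 < s -> covered_by A l -> lengths_le d l ->
  (hausdorff_premeasure s d A <= (\sum_(I <- l) (I.2 - I.1) `^ s)%:E)%E.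
Proof.
move=> s_gt0 cov len.
pose U (i : nat) : set R := if (i < size l)%N then
  `[(nth (0, 0) l i).1, (nth (0, 0) l i).2]%classic else set0.
apply: (@le_trans _ _ (\sum_(0 <= i <oo) hausdorff_weight s (U i))%E).
  apply: ereal_inf_lbound; exists U => //; split.
    move=> z /cov[I I_l z_I]; exists (index I l) => //.
    by rewrite /U index_mem I_l nth_index//= in_itv.
  move=> i; rewrite /U; case: ifP => [lt_il|_].
    apply: le_trans (diam_segment _ _) _; rewrite lee_fin.
    by have /andP[] := len _ (mem_nth (0, 0) lt_il).
  by apply: ge_ereal_sup => _ [? [[]]].
rewrite (nneseries_split 0 (size l)); last by move=> *; exact: hausdorff_weight_ge0.
rewrite add0n [X in (_ + X)%E]eseries0 ?adde0; last first.
  by move=> i le_li _; rewrite /U ltnNge le_li/= /hausdorff_weight eqxx.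
rewrite (big_nth (0, 0)) -sumEFin !big_nat.
apply: lee_sum => i /andP[_ lt_il]; rewrite /U lt_il.
apply: hausdorff_weight_segment => //.
by rewrite -subr_ge0; have /andP[] := len _ (mem_nth (0, 0) lt_il).
Qed.

Lemma hausdorff_premeasure_ge0 (R : realType) (s d : R) (A : set R) :
  (0 <= hausdorff_premeasure s d A)%E.
Proof.
apply: le_ereal_inf_tmp => _ [U _ <-].
by apply: nneseries_ge0 => *; exact: hausdorff_weight_ge0.
Qed.

(** Covers of arbitrarily small total weight, at every scale, show that the
    [s]-dimensional measure vanishes. *)
Lemma hausdorff_dim_le (R : realType) (s : R) (A : set R) : 0 < s ->
  (forall d e : R, 0 < d -> 0 < e -> exists l, [/\ covered_by A l, lengths_le d l &
    \sum_(I <- l) (I.2 - I.1) `^ s <= e]) ->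
  (hausdorff_dim A <= s%:E)%E.
Proof.
move=> s_gt0 fine_cover; apply: ereal_inf_lbound; exists s => //.
split; first exact: ltW.
apply/eqP; rewrite eq_le; apply/andP; split; last first.
  apply: (le_trans (hausdorff_premeasure_ge0 s 1 A)).
  by apply: ereal_sup_ubound; exists 1 => //=; exact: ltr01.
apply: ge_ereal_sup => _ [d /= d_gt0 <-].
apply/lee_addgt0Pr => e e_gt0; rewrite add0e.
have [l [cov len sum_le]] := fine_cover d e d_gt0 e_gt0.
by apply: le_trans (hausdorff_premeasure_le s_gt0 cov len) _; rewrite lee_fin.
Qed.

(** For [c = 0] the powers vanish as soon as [s] is nonzero, in agreement with
    the limit; for [c > 0] this is the continuity of the exponential. *)
Lemma powR_cvg_exponent1 (R : realType) (c : R) : 0 <= c ->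
  c `^ s @[s --> (1 : R)^'-] --> c.
Proof.
rewrite le_eqVlt => /predU1P[<-|c_gt0].
  apply: cvg_near_cst; near=> s; rewrite powR0//.
  have s_gt0 : 0 < s by near: s; apply: nbhs_left_gt; exact: ltr01.
  by rewrite gt_eqF.
apply: cvg_at_left_filter.
rewrite -[X in _ --> X](powRr1 (ltW c_gt0)) /powR gt_eqF//.
apply: (@cvg_comp _ _ _ (fun s => s * ln c) expR _ (nbhs (1 * ln c))); last exact: continuous_expR.
by apply: cvgMl; exact: cvg_id.
Unshelve. all: by end_near. Qed.

Lemma exponent_below1 (R : realType) (c1 c2 : R) : 0 <= c1 -> 0 <= c2 -> c1 + c2 < 1 ->
  exists2 s : R, 0 < s < 1 & c1 `^ s + c2 `^ s < 1.
Proof.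
move=> c1_ge0 c2_ge0 lt1.
have sum_cvg : c1 `^ s + c2 `^ s @[s --> (1 : R)^'-] --> c1 + c2.
  by apply: cvgD; exact: powR_cvg_exponent1.
near (1 : R)^'- => s.
exists s; last by near: s; exact: (cvgr_lt _ sum_cvg).
apply/andP; split; near: s; [exact: nbhs_left_gt|exact: nbhs_left_lt].
Unshelve. all: by end_near. Qed.

Lemma geometric_lt (R : realType) (c e : R) : 0 <= c -> c < 1 -> 0 < e ->
  \forall n \near \oo, c ^+ n < e.
Proof.
move=> c_ge0 c_lt1 e_gt0.
have c_cvg : c ^+ n @[n --> \oo] --> (0 : R) by apply: cvg_expr; rewrite ger0_norm.
exact: (cvgr_lt _ c_cvg).
Qed.

(** For [s] close enough to 1 both factors of [avoids_positions_cover] are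
    less than 1, so the lengths and the sum of their powers tend to 0; the
    factors, hence [s], are the same for all the sets. *)
Lemma avoids_positions_dim (R : realType) (p q : R) : 0 <= p -> p < q -> q <= 1 ->
  exists2 s : R, 0 < s < 1 & forall E : set R, compact E -> E `<=` `[0, 1] ->
    avoids_positions p q E -> (hausdorff_dim E <= s%:E)%E.
Proof.
move=> p_ge0 lt_pq q_le1.
have [|||s /andP[s_gt0 s_lt1] theta_lt1] := @exponent_below1 R (1 - q) p; [lra..|].
exists s; first by rewrite s_gt0.
move=> E cE E01 avoid; apply: hausdorff_dim_le => // d e d_gt0 e_gt0.
have [N [lt_d lt_e]] : exists N : nat,
    (1 - (q - p)) ^+ N < d /\ ((1 - q) `^ s + p `^ s) ^+ N < e.
  near \oo => N; exists N; split; near: N; apply: geometric_lt => //; try lra.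
  by rewrite addr_ge0 ?powR_ge0.
have [l [cov len sum_le]] :=
  avoids_positions_cover p_ge0 lt_pq q_le1 s_gt0 cE avoid N (@ler01 R).
exists l; split.
- by move=> z Ez; apply: cov; split => //; exact: E01.
- move=> I /len; rewrite subr0 mulr1 => /andP[-> /= /le_trans]; apply; exact: ltW.
- by apply: le_trans sum_le _; rewrite subr0 powR1 mulr1 ltW.
Unshelve. all: by end_near. Qed.

Theorem theorem1p2 (R : realType) (g : R -> R) :
  Theta_bounded 1 g ->
  exists eps : R, 0 < eps < 1 /\
    forall E : set R, compact E -> E `<=` `[0, 1] ->
      ((1 - eps)%:E < hausdorff_dim E)%E ->
      exists x l t : R, [/\ 0 < l, 0 < t, l * t \in `[0, 1] &
        [/\ E x, E (x - t) & E (x - rescale l g t)]].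
Proof.
move=> [g_Theta _].
have [[al be] /= lt_ab slopes] := slopes_fill_interval
  (analytic01_continuous (Theta_analytic g_Theta)) (Theta_not_affine g_Theta)
  (Theta_at0 g_Theta).
have [p [q [p_ge0 lt_pq q_le1 ratios]]] := position_of_ratio lt_ab.
have [s /andP[s_gt0 s_lt1] dim_le] := avoids_positions_dim p_ge0 lt_pq q_le1.
exists (1 - s); split; first by apply/andP; split; lra.
move=> E cE E01; rewrite subKr ltNge => /negP dim_gt; apply: contrapT => no_config.
apply: dim_gt; apply: dim_le => // X Y u EX EY ltYX u_in EU; apply: no_config.
have [r r_in realize] := ratios u u_in.
have [[x t] /= t_gt0 [Ex Ext Exrt]] := realize E X Y ltYX EX EY EU.
have [v /andP[v_gt0 v_le1] gv] := slopes r r_in.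
have t_neq0 : t != 0 by rewrite gt_eqF.
exists x, (v / t), t; rewrite mulfVK//; split=> //.
- exact: divr_gt0.
- by rewrite in_itv/= v_le1 ltW.
(* The scale [v / t] makes [rescale (v / t) g t = (t / v) * g v = r * t]. *)
- split=> //; rewrite /rescale mulfVK// gv.
  by rewrite (_ : _ * (r * v) = r * t)//; field; rewrite t_neq0 gt_eqF.
Qed.
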